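(* Let $\mathcal{H}$ and $\mathcal{G}$ be real Hilbert spaces, let $L\colon\mathcal{H}\to\mathcal{G}$ be a bounded linear operator with $\|L\|\leq 1$, and let $B\colon\mathcal{G}\to2^{\mathcal{G}}$ be maximally monotone. Assume that $L^*\circ B\circ L$ is maximally monotone. Then the following hold: (i) $L\overset{\gamma}{\bullet}B$ graph-converges to $L^*\circ B\circ L$ as $0<\gamma\to 0$. (ii) Suppose that one of the following is satisfied: (a) $\operatorname{ran}(B\circ L)$ is bounded. (b) There exists a bounded linear operator $S\colon\mathcal{H}\to\mathcal{G}$ such that $S\circ L^*$ is invertible. Then, for every $\rho\in(0,+\infty)$, $\lim_{0<\gamma\to 0}\operatorname{haus}_{\rho}(L\overset{\gamma}{\bullet}B,\,L^*\circ B\circ L)=0$.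
   Context: A set-valued operator $A\colon\mathcal{H}\to2^{\mathcal{H}}$ has graph $\operatorname{gra}A=\{(x,x^* )\mid x^*\in Ax\}$; it is maximally monotone if it is monotone ($\langle x_1-x_2\mid x_1^*-x_2^*\rangle\geq 0$ for all $(x_1,x_1^* ),(x_2,x_2^* )\in\operatorname{gra}A$) and its graph is not properly contained in the graph of another monotone operator. $\operatorname{ran}$ denotes the range (union of the values). $A^{-1}$ is defined by $x\in A^{-1}x^*\Leftrightarrow x^*\in Ax$. Sums, scalar multiples and compositions are pointwise, e.g. $(L^*\circ C\circ L)x=\{L^*y\mid y\in C(Lx)\}$. For a bounded linear $L\colon\mathcal{H}\to\mathcal{G}$ with adjoint $L^*$ and $C\colon\mathcal{G}\to2^{\mathcal{G}}$, the parallel composition is $L^*\triangleright C=(L^*\circ C^{-1}\circ L)^{-1}\colon\mathcal{H}\to2^{\mathcal{H}}$. For $\gamma>0$, the resolvent composition is $L\overset{\gamma}{\diamond}C=L^*\triangleright(C+\gamma^{-1}\mathrm{Id}_{\mathcal{G}})-\gamma^{-1}\mathrm{Id}_{\mathcal{H}}$, and the resolvent cocomposition is $L\overset{\gamma}{\bullet}C=(L\overset{1/\gamma}{\diamond}C^{-1})^{-1}$. Graph-convergence: for a sequence $(C_n)_{n\in\mathbb{N}}$ of subsets of a Hilbert space, the lower limit is the set of $x$ for which there exist $x_n\in C_n$ (for all $n\in\mathbb{N}$) with $x_n\to x$ (strongly); the upper limit is the set of $x$ for which there exist a strictly increasing sequence $(k_n)_{n\in\mathbb{N}}$ in $\mathbb{N}$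 and points $x_n\in C_{k_n}$ with $x_n\to x$. The sequence converges in the Painlevé–Kuratowski sense if the two coincide, the common set being its limit. Operators $(A_n)_{n\in\mathbb{N}}$ graph-converge to $A$ if $(\operatorname{gra}A_n)_{n\in\mathbb{N}}$ converges to $\operatorname{gra}A$ in this sense in $\mathcal{H}\times\mathcal{H}$. A family $(A_\gamma)_{\gamma>0}$ graph-converges to $A$ as $0<\gamma\to0$ if $(A_{\gamma_n})_{n\in\mathbb{N}}$ graph-converges to $A$ for every sequence $(\gamma_n)_{n\in\mathbb{N}}$ in $(0,+\infty)$ with $\gamma_n\to0$. $\rho$-Hausdorff distance: for subsets $C,D$ of a normed space and $\rho\geq0$, let $e(C,D)=\sup_{x\in C}d_D(x)$ (with $d_D$ the distance function to $D$ and $e(\varnothing,D)=0$), let $C_\rho=C\cap B(0;\rho)$, $D_\rho=D\cap B(0;\rho)$ with $B(0;\rho)$ the closed ball, and $\operatorname{haus}_\rho(C,D)=\max\{e(C_\rho,D),e(D_\rho,C)\}$. For operators, $\operatorname{haus}_\rho(A_1,A_2)=\operatorname{haus}_\rho(\operatorname{gra}A_1,\operatorname{gra}A_2)$, where $\mathcal{H}\times\mathcal{H}$ carries the norm $\|(x,x^* )\|=\max\{\|x\|,\|x^*\|\}$. *)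

(* Defs.v *)
From HB Require Import structures.
From mathcomp Require Import all_boot all_order all_algebra.
From mathcomp Require Import all_classical all_reals all_analysis.

Set Implicit Arguments.
Unset Strict Implicit.
Unset Printing Implicit Defensive.

Import Order.TTheory GRing.Theory Num.Theory.
Import numFieldNormedType.Exports.

Local Open Scope classical_set_scope.
Local Open Scope ring_scope.

HB.mixin Record CompleteNormedModule_isHilbert (R : realType) H
    & CompleteNormedModule R H := {
  inner : {dot H for idfun};
  inner_normE : forall x : H, inner x x = `|x| ^+ 2
}.

#[short(type="hilbertType")]
HB.structure Definition Hilbert (R : realType) :=
  {H of CompleteNormedModule R H & CompleteNormedModule_isHilbert R H}.

Section BoundedOperators.
Context {R : realType}.

Definition bounded_operator {V W : normedModType R} (f : {linear V -> W}) :=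
  bounded_near f (nbhs (0 : V)).

Definition opnorm {V W : normedModType R} (f : V -> W) : \bar R :=
  ereal_sup [set (`|f x|)%:E | x in [set x : V | `|x| <= 1]].

(* The vector z is unique when it exists, and it exists for every bounded
   linear L by the Riesz representation theorem; 0 is only a junk value. *)
Definition adjoint {H G : hilbertType R} (L : H -> G) (y : G) : H :=
  xget 0 [set z : H | forall x : H, inner (L x) y = inner x z].

(* Invertibility in the algebra of bounded linear operators on V. *)
Definition invertible_operator {V : normedModType R} (f : V -> V) :=
  exists g : {linear V -> V},
    [/\ bounded_operator g, cancel f g & cancel g f].

End BoundedOperators.

Section SetValuedOperators.
Context {R : realType}.

Definition gra {U V : Type} (A : U -> set V) : set (U * V) :=
  [set p | A p.1 p.2].

Definition ran {U V : Type} (A : U -> set V) : set V := \bigcup_x A x.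

Definition op_inv {U V : Type} (A : U -> set V) : V -> set U :=
  fun v => [set u | A u v].

Definition op_id {V : Type} : V -> set V := fun x => [set x].

Definition op_add {U V : lmodType R} (A B : U -> set V) : U -> set V :=
  fun x => [set u + v | u in A x & v in B x].

Definition op_scale {U V : lmodType R} (c : R) (A : U -> set V) : U -> set V :=
  fun x => [set c *: u | u in A x].

Definition op_comp {U V V' W : Type} (M : V' -> W) (C : V -> set V')
    (L : U -> V) : U -> set W :=
  fun x => [set M y | y in C (L x)].

Definition monotone {H : hilbertType R} (A : H -> set H) :=
  forall p q : H * H, gra A p -> gra A q ->
    0 <= inner (p.1 - q.1) (p.2 - q.2).

Definition maximally_monotone {H : hilbertType R} (A : H -> set H) :=
  monotone A /\
  ~ exists A' : H -> set H, monotone A' /\ gra A `<` gra A'.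

Definition parallel_comp {H G : hilbertType R} (L : H -> G)
    (C : G -> set G) : H -> set H :=
  op_inv (op_comp (adjoint L) (op_inv C) L).

Definition resolvent_comp {H G : hilbertType R} (L : H -> G) (gamma : R)
    (C : G -> set G) : H -> set H :=
  op_add (parallel_comp L (op_add C (op_scale gamma^-1 op_id)))
         (op_scale (- gamma^-1) op_id).

Definition resolvent_cocomp {H G : hilbertType R} (L : H -> G) (gamma : R)
    (C : G -> set G) : H -> set H :=
  op_inv (resolvent_comp L gamma^-1 (op_inv C)).

End SetValuedOperators.

Section Convergence.
Context {R : realType}.

Definition lower_limit {T : topologicalType} (C : nat -> set T) : set T :=
  [set x | exists u : nat -> T, (forall n, C n (u n)) /\ u @ \oo --> x].

Definition upper_limit {T : topologicalType} (C : nat -> set T) : set T :=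
  [set x | exists (k : nat -> nat) (u : nat -> T),
    [/\ {homo k : m n / (m < n)%N}, forall n, C (k n) (u n)
      & u @ \oo --> x]].

Definition pk_cvg {T : topologicalType} (C : nat -> set T) (D : set T) :=
  lower_limit C = D /\ upper_limit C = D.

Definition graph_cvg {H : hilbertType R} (A : nat -> H -> set H)
    (A0 : H -> set H) :=
  pk_cvg (fun n => gra (A n)) (gra A0).

Definition graph_cvg_at0 {H : hilbertType R} (A : R -> H -> set H)
    (A0 : H -> set H) :=
  forall gamma : nat -> R, (forall n, 0 < gamma n) ->
    gamma @ \oo --> 0 -> graph_cvg (fun n => A (gamma n)) A0.

(* Distances are extended-real valued: the distance to the empty set is +oo. *)
Definition dist_to {V : normedModType R} (D : set V) (x : V) : \bar R :=
  ereal_inf [set (`|x - y|)%:E | y in D].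

(* The empty set needs its own case because ereal_sup set0 is -oo. *)
Definition excess {V : normedModType R} (C D : set V) : \bar R :=
  if `[< C = set0 >] then 0%E else ereal_sup [set dist_to D x | x in C].

Definition haus {V : normedModType R} (rho : R) (C D : set V) : \bar R :=
  let B := [set x : V | `|x| <= rho] in
  Order.max (excess (C `&` B) D) (excess (D `&` B) C).

(* The library's norm on a product is the maximum of the two norms. *)
Definition op_haus {H : hilbertType R} (rho : R) (A1 A2 : H -> set H) :
    \bar R :=
  haus rho (gra A1 : set (H * H)%type) (gra A2).

End Convergence.

(* Main.v *)
(* Write [A = L^* B L] and [T = Id - L L^*], a nonnegative operator.  Unfolding
   the cocomposition [A_g], its graph is the set of pairs [(x, L^* y)] with
   [y] in [B (L x - g T y)].  Points of the two graphs with the same sum,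
   [x + L^* y = p + L^* w] with [y] in [B (L x)] and [w] in [B (L p - g T w)],
   satisfy [4 |x - p|^2 <= g |y|^2] by monotonicity of [B].  Such pairs exist
   by Minty's theorem, applied to [A] or to [A_g]; the latter is maximally
   monotone because [Id + g A_g] is onto, its inverse being expressed by the
   resolvent of [B].  This gives graph convergence, and convergence for the
   Hausdorff distances as soon as [|y|] is bounded on bounded parts of the
   graph of [A], which both (a) and (b) ensure. *)
From HB Require Import structures.
Require Import Defs.
From mathcomp Require Import all_boot all_order all_algebra.
From mathcomp Require Import all_classical all_reals all_analysis.
From mathcomp Require Import ring lra.

Set Implicit Arguments.
Unset Strict Implicit.
Unset Printing Implicit Defensive.

Import Order.TTheory GRing.Theory Num.Theory.
Import numFieldNormedType.Exports.

Local Open Scope classical_set_scope.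
Local Open Scope ring_scope.

(** * Hilbert spaces *)

Section InnerProduct.
Context {R : realType} {H : hilbertType R}.
Implicit Types x y z : H.

Lemma innerC x y : inner x y = inner y x.
Proof. by rewrite hermC expr0 mul1r. Qed.

Lemma innerDl x y z : inner (x + y) z = inner x z + inner y z.
Proof. exact: linearDl. Qed.

Lemma innerDr x y z : inner z (x + y) = inner z x + inner z y.
Proof. exact: linearDr. Qed.

Lemma innerNl x y : inner (- x) y = - inner x y.
Proof. exact: linearNl. Qed.

Lemma innerNr x y : inner x (- y) = - inner x y.
Proof. exact: linearNr. Qed.

Lemma innerZl a x y : inner (a *: x) y = a * inner x y.
Proof. exact: linearZl_LR. Qed.

Lemma innerZr a x y : inner x (a *: y) = a * inner x y.
Proof. exact: linearZr_LR. Qed.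

Lemma inner0l x : inner 0 x = 0.
Proof. exact: linear0l. Qed.

Lemma inner0r x : inner x 0 = 0.
Proof. exact: linear0r. Qed.

Definition innerE := (innerDl, innerDr, innerNl, innerNr, innerZl, innerZr).

Lemma inner_ge0 x : 0 <= inner x x.
Proof. by rewrite inner_normE exprn_ge0. Qed.

Lemma inner_eq0 x : (inner x x == 0) = (x == 0).
Proof. by rewrite inner_normE sqrf_eq0 normr_eq0. Qed.

Lemma inner_le_norm x y : inner x y <= `|x| * `|y|.
Proof.
have [->|y0] := eqVneq y 0; first by rewrite inner0r mulr_ge0.
have ny : 0 < `|y| by rewrite normr_gt0.
have [->|x0] := eqVneq x 0; first by rewrite inner0l mulr_ge0.
have nx : 0 < `|x| by rewrite normr_gt0.
have := inner_ge0 (`|y| *: x - `|x| *: y).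
rewrite !innerE !inner_normE (innerC y x) => h.
have {}h : (`|x| * `|y|) * inner x y <= (`|x| * `|y|) * (`|x| * `|y|) by lra.
by rewrite ler_pM2l ?mulr_gt0 in h.
Qed.

Lemma inner_polarization x y :
  inner x y = 4^-1 * (`|x + y| ^+ 2 - `|x - y| ^+ 2).
Proof. by rewrite -!inner_normE !innerE (innerC y x); field. Qed.

(** Polarization reduces joint continuity to continuity of the norm. *)
Lemma cvg_inner (I : Type) (F : set_system I) (FF : Filter F)
    (f g : I -> H) (a b : H) :
  f @ F --> a -> g @ F --> b -> inner (f i) (g i) @[i --> F] --> inner a b.
Proof.
move=> fa gb; rewrite inner_polarization.
under eq_fun do rewrite inner_polarization.
apply: cvgMr; apply: cvgB; under eq_fun do rewrite expr2; rewrite expr2.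
  by apply: cvgM; apply: cvg_norm; apply: cvgD.
by apply: cvgM; apply: cvg_norm; apply: cvgB.
Qed.

End InnerProduct.

(** * Completeness of products *)

HB.instance Definition _ (U V : puniformType) := Pointed.on (U * V)%type.

Lemma prod_complete (U V : completeType) (F : set_system (U * V)%type)
    (FF : ProperFilter F) : cauchy F -> cvg F.
Proof.
move=> Fc.
have /cauchy_cvg/cvg_ex[u Fu] : cauchy (fst @ F).
  move=> A entA.
  have entB : entourage [set p : (U * V) * (U * V) | A (p.1.1, p.2.1)].
    exists (A, setT) => /=; first by split => //; exact: entourageT.
    by move=> [[a b] [c d]] /= [? ?]; exists ((a, c), (b, d)).
  have [[P Q] [FP FQ] PQA] := Fc _ entB.
  exists (fst @` P, fst @` Q) => /=.
    by split; [apply: filterS FP | apply: filterS FQ] => p pP; exists p.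
  move=> /= [a b] [/= [p Pp <-] [q Qq <-]].
  exact: (PQA (p, q)).
have /cauchy_cvg/cvg_ex[v Fv] : cauchy (snd @ F).
  move=> A entA.
  have entB : entourage [set p : (U * V) * (U * V) | A (p.1.2, p.2.2)].
    exists (setT, A) => /=; first by split => //; exact: entourageT.
    by move=> [[a b] [c d]] /= [? ?]; exists ((a, c), (b, d)).
  have [[P Q] [FP FQ] PQA] := Fc _ entB.
  exists (snd @` P, snd @` Q) => /=.
    by split; [apply: filterS FP | apply: filterS FQ] => p pP; exists p.
  move=> /= [a b] [/= [p Pp <-] [q Qq <-]].
  exact: (PQA (p, q)).
apply/cvg_ex; exists (u, v).
suff : (fun p : U * V => (p.1, p.2)) @ F --> (u, v).
  by move=> h A /h FA; apply: (@filterS _ F _ _ _ _ FA) => -[].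
exact: (cvg_pair Fu Fv).
Qed.

HB.instance Definition _ (K : numFieldType) (U V : completeNormedModType K) :=
  Uniform_isComplete.Build (U * V)%type (@prod_complete U V).

(** * Minimization and Riesz representation *)

(* The set [E] plays the role of the epigraph of a function with values in
   ]-oo, +oo]; the gap [D] in the convexity inequality reappears, with the same
   constant, as the growth away from the minimizer. *)
Lemma uniformly_convex_min (R : realType) (V : completeNormedModType R)
    (E : set (V * R)) (D : V -> V -> R) (c b : R) :
  0 < c -> (forall p q, c * `|p - q| ^+ 2 <= D p q) ->
  closed E -> E !=set0 -> (forall x, E x -> b <= x.2) ->
  (forall x y l, E x -> E y -> 0 <= l <= 1 ->
     E ((1 - l) *: x.1 + l *: y.1,
        (1 - l) * x.2 + l * y.2 - l * (1 - l) * D x.1 y.1)) ->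
  exists2 x, E x & forall y, E y -> x.2 + D x.1 y.1 <= y.2.
Proof.
move=> c0 cD Ecl [x0 Ex0] Eb Econv.
pose S := [set x.2 | x in E].
have Sinf : has_inf S.
  by split; [exists x0.2, x0 | exists b => _ [x Ex <-]; exact: Eb].
pose m := inf S.
have mE x : E x -> m <= x.2.
  by move=> Ex; apply: ge_inf; [case: Sinf | exists x].
have DE x y : E x -> E y -> D x.1 y.1 <= 2 * (x.2 - m) + 2 * (y.2 - m).
  (* The midpoint given by convexity cannot lie below [m]. *)
  move=> Ex Ey; have h : 0 <= (2^-1 : R) <= 1 by apply/andP; split; lra.
  by have /mE /= := Econv _ _ _ Ex Ey h; lra.
have /choice[u uE] n : exists x, E x /\ x.2 < m + n.+1%:R^-1.
  have [||_ [x Ex <-] xm] := @inf_adherent _ S n.+1%:R^-1 => //.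
  by exists x.
have /cauchy_cvg/cvg_ex[p up] : cauchy ((fst \o u) @ \oo).
  (* The index makes [4 / (N + 1) < c * e ^+ 2]; by [DE], the left side dominates [D] between the
     indices [N] and [i >= N]. *)
  apply/cauchy_exP => e e0; exists (u (Num.truncn (4 / (c * e ^+ 2)))).1.
  set N := Num.truncn _.
  have ce : 0 < c * e ^+ 2 by rewrite mulr_gt0 ?exprn_gt0.
  have hN : 4 * N.+1%:R^-1 < c * e ^+ 2.
    by rewrite ltr_pdivrMr // mulrC -ltr_pdivrMr //; exact: truncnS_gt.
  exists N => // i /= Ni; rewrite -ball_normE /ball_ /=.
  have iN : (i.+1%:R^-1 : R) <= N.+1%:R^-1.
    by rewrite lef_pV2 ?posrE // ler_nat.
  have [Ei mi] := uE i; have [EN mN] := uE N.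
  have h1 := DE _ _ EN Ei.
  have h2 := cD (u N).1 (u i).1.
  have h3 : c * `|(u N).1 - (u i).1| ^+ 2 < c * e ^+ 2.
    apply: le_lt_trans h2 _; apply: le_lt_trans h1 _; apply: lt_trans hN.
    move: iN mi mN; set a := i.+1%:R^-1; set d := N.+1%:R^-1; lra.
  by move: h3; rewrite ltr_pM2l // ltr_pXn2r ?nnegrE ?normr_ge0 // ltW.
have um : (snd \o u) n @[n --> \oo] --> m.
  apply: (@squeeze_cvgr _ _ _ _ (fun=> m) (fun n => m + n.+1%:R^-1)).
  - by near=> n; have [/mE ? ?] := uE n; apply/andP; split => //; exact: ltW.
  - exact: cvg_cst.
  - rewrite -[X in _ --> X]addr0; apply: cvgD; first exact: cvg_cst.
    exact: cvg_harmonic.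
have Epm : E (p, m).
  apply: (@closed_cvg _ (V * R)%type \oo _ (fun n => ((u n).1, (u n).2)) E
    Ecl _ (p, m) (cvg_pair up um)); near=> n => /=.
  by rewrite -surjective_pairing; have [] := uE n.
exists (p, m) => // y Ey /=; rewrite leNgt; apply/negP => lt.
have my := mE _ Ey.
have D0 : 0 < D p y.1 by lra.
(* Half the relative deficit of [y]: the point that convexity gives at weight [l] then lies
   [l (m + D p y.1 - y.2) / 2] below [m]. *)
pose l := (m + D p y.1 - y.2) / (2 * D p y.1).
have lD : l * D p y.1 = (m + D p y.1 - y.2) / 2.
  by rewrite /l; field; rewrite gt_eqF.
have l0 : 0 < l by rewrite /l divr_gt0 //; lra.
have l1 : l <= 1 by rewrite /l ler_pdivrMr; lra.
have l01 : 0 <= l <= 1 by rewrite ltW.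
have /mE /= := Econv _ _ _ Epm Ey l01.
have -> : (1 - l) * m + l * y.2 - l * (1 - l) * D p y.1 =
  m + l * (y.2 - m - D p y.1 + l * D p y.1) by ring.
rewrite lerDl pmulr_rge0 // lD; lra.
Unshelve. all: by end_near. Qed.

(** The representing vector minimizes [|x|^2 / 2 - f x], whose convexity gap is exactly
    [|p - q|^2 / 2]. Growth at the minimizer gives [f y <= inner y z], and the sign change of [y]
    gives equality. *)
Lemma riesz_representation (R : realType) (H : hilbertType R) (f : H -> R)
    (C : R) : scalar f -> continuous f -> (forall x, f x <= C * `|x|) ->
  exists z, forall x, f x = inner x z.
Proof.
move=> flin fcont fC.
have f0 : f 0 = 0.
  by have := flin (-1) 0 0; rewrite scaler0 addr0 mulN1r addNr.
have fD x y : f (x + y) = f x + f y.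
  by rewrite -[x in LHS]scale1r flin mul1r.
have fZ a x : f (a *: x) = a * f x.
  by rewrite -[a *: x]addr0 flin f0 addr0.
have fN x : f (- x) = - f x by rewrite -scaleN1r fZ mulN1r.
pose E := [set x : H * R | 2^-1 * `|x.1| ^+ 2 - f x.1 <= x.2].
have [|||||| [z t] Ezt zmin] := @uniformly_convex_min R H E
  (fun p q => 2^-1 * `|p - q| ^+ 2) 2^-1 (- (2^-1 * C ^+ 2)).
- by [].
- by [].
- have -> : E = (fun x : H * R =>
      x.2 - (2^-1 * (`|x.1| * `|x.1|) - f x.1)) @^-1` [set t | 0 <= t].
    by apply/seteqP; split=> x; rewrite /E /= subr_ge0 expr2.
  apply: preimage_closed (@closed_ge R 0) => x _.
  have c1 : y.1 @[y --> x] --> x.1 by apply: cvg_fst.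
  apply: cvgB; first by apply: cvg_snd.
  have c2 : f y.1 @[y --> x] --> f x.1.
    exact: (cvg_comp (@fst H R) f c1 (fcont x.1)).
  apply: cvgB => //.
  by apply: cvgMr; apply: cvgM; exact: cvg_norm.
- by exists (0, 0); rewrite /E /= normr0 f0 expr0n /= mulr0 subrr.
- move=> x; apply: le_trans; have := fC x.1.
  by have := sqr_ge0 (`|x.1| - C); rewrite expr2 => ? ?; nra.
- move=> x y l Ex Ey /andP[l0 l1].
  have h1 : (1 - l) * (2^-1 * `|x.1| ^+ 2 - f x.1) <= (1 - l) * x.2.
    by rewrite ler_wpM2l // subr_ge0.
  have h2 : l * (2^-1 * `|y.1| ^+ 2 - f y.1) <= l * y.2.
    by rewrite ler_wpM2l.
  move: h1 h2; rewrite /E /= fD !fZ -!inner_normE !innerE (innerC y.1 x.1).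
  lra.
exists z => x.
have le y : f y <= inner y z.
  have := zmin (y + z, 2^-1 * `|y + z| ^+ 2 - f (y + z)) (lexx _).
  move: Ezt; rewrite /E /= fD opprD addrCA subrr addr0 normrN.
  rewrite -!inner_normE !innerE (innerC z y); lra.
apply/eqP; rewrite eq_le le /=.
by have := le (- x); rewrite fN innerNl lerN2.
Qed.

(** * Adjoints and Minty's theorem *)

Section Adjoint.
Context {R : realType} {H G : hilbertType R} (L : {linear H -> G}).
Hypothesis L_cont : continuous L.
Hypothesis L_le1 : forall x, `|L x| <= `|x|.

(** Riesz representation of [x |-> inner (L x) y], with bound [|y|], rules out the default value in
    [adjoint]. *)
Lemma inner_adjoint x y : inner (L x) y = inner x (adjoint L y).
Proof.
rewrite /adjoint; case: xgetP => [z _ -> //|none]; exfalso.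
have [||| z zE] := @riesz_representation R H (fun x => inner (L x) y) `|y|.
- by move=> a u v; rewrite linearP innerDl innerZl.
- by move=> u; apply: cvg_inner; [exact: L_cont | exact: cvg_cst].
- move=> u; apply: le_trans (inner_le_norm _ _) _.
  by rewrite mulrC ler_wpM2l.
exact: none z zE.
Qed.

Lemma adjoint_is_linear : linear (adjoint L).
Proof.
move=> a u v; apply/eqP; rewrite -subr_eq0 -inner_eq0; apply/eqP.
set w := (X in inner X _).
by rewrite !innerE -!inner_adjoint !innerE; ring.
Qed.

Lemma adjoint_le1 y : `|adjoint L y| <= `|y|.
Proof.
have [->|z0] := eqVneq (adjoint L y) 0; first by rewrite normr0.
have nz : 0 < `|adjoint L y| by rewrite normr_gt0.
rewrite -(ler_pM2l nz) -expr2 -inner_normE -inner_adjoint.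
apply: le_trans (inner_le_norm _ _) _.
by rewrite ler_wpM2r.
Qed.

End Adjoint.

Section Minty.
Context {R : realType} {H : hilbertType R}.
Implicit Types A : H -> set H.

Definition monotonically_related A (p : H * H) :=
  forall q, gra A q -> 0 <= inner (p.1 - q.1) (p.2 - q.2).

(** A related point outside the graph could be adjoined to it without losing monotonicity. *)
Lemma maximally_monotoneP A : maximally_monotone A <->
  Defs.monotone A /\ forall p, monotonically_related A p -> gra A p.
Proof.
split=> [[monA maxA]|[monA relA]]; split=> //.
  move=> p relp; apply: contrapT => nAp; apply: maxA.
  exists (fun x => A x `|` [set u | (x, u) = p]); split; last first.
    split; first by move=> q Aq; left.
    by move=> /(_ p) sub; apply/nAp/sub; right; rewrite /= -surjective_pairing.
  move=> q r; rewrite /gra /= -!surjective_pairing.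
  case=> [Aq|->]; case=> [Ar|->].
  - exact: monA.
  - rewrite -[q.1 - _]opprB -[q.2 - _]opprB innerNl innerNr opprK.
    exact: relp.
  - exact: relp.
  - by rewrite !subrr inner0l.
case=> A' [monA' [sub nsub]]; apply: nsub => p A'p; apply: relA => q Aq.
by apply: monA' => //; exact: sub.
Qed.

Lemma maximally_monotone_nonempty A : maximally_monotone A -> gra A !=set0.
Proof.
move=> /maximally_monotoneP[_ relA]; apply: contrapT => A0.
by apply: (A0); exists (0, 0); apply: relA => q Aq; case: A0; exists q.
Qed.

(* Minimize the Fitzpatrick function of [A] plus half the squared norm: by
   maximality the infimum is nonnegative, and the growth at the minimizer
   (x, u) makes (-u, -x) monotonically related to [A]. *)
Lemma minty0 A : maximally_monotone A -> exists x, A x (- x).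
Proof.
move=> maxA; have [monA relA] := (maximally_monotoneP A).1 maxA.
have [q0 Aq0] := maximally_monotone_nonempty maxA.
(* The supremum of [h q x] over [q] in the graph is the Fitzpatrick function at [x] plus half the
   squared norm; [E] is its epigraph. *)
pose h (q x : H * H) := inner x.1 q.2 + inner q.1 x.2 - inner q.1 q.2
  + 2^-1 * (inner x.1 x.1 + inner x.2 x.2).
pose E := [set x : H * H * R | forall q, gra A q -> h q x.1 <= x.2].
(* The sum of squares dominates the squared maximum norm of [H * H]. *)
pose D (p q : H * H) := 2^-1 * (inner (p.1 - q.1) (p.1 - q.1)
  + inner (p.2 - q.2) (p.2 - q.2)).
have E_self q : gra A q ->
    E (q, inner q.1 q.2 + 2^-1 * (inner q.1 q.1 + inner q.2 q.2)).
  move=> Aq r Ar; have := monA _ _ Aq Ar.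
  by rewrite /h /= !innerE (innerC r.1 q.2) (innerC q.2 r.1); lra.
(* The Fitzpatrick function dominates [inner x.1 x.2]: outside the graph, maximality yields a graph
   point [q] violating monotonicity with [x]. *)
have E_ge x : E x -> 2^-1 * inner (x.1.1 + x.1.2) (x.1.1 + x.1.2) <= x.2.
  move=> Ex; have [q [Aq q_le]] :
      exists q, gra A q /\ inner (x.1.1 - q.1) (x.1.2 - q.2) <= 0.
    have [Ax|nAx] := pselect (gra A x.1).
      by exists x.1; rewrite !subrr inner0l.
    apply: contrapT => none; apply: nAx; apply: relA => q Aq.
    by rewrite leNgt; apply/negP => /ltW ?; apply: none; exists q.
  have := Ex _ Aq; move: q_le.
  rewrite /h !innerE (innerC q.1 x.1.2) (innerC x.1.2 x.1.1); lra.
have [|||||| [w t] Ewt wmin] := @uniformly_convex_min R (H * H)%type E D 2^-1 0.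
- by [].
- move=> p q; rewrite /D ler_pM2l // !inner_normE prod_normE /=.
  by rewrite maxEle; case: ifP => _; rewrite ?lerDl ?lerDr sqr_ge0.
- have -> : E = \bigcap_(q in gra A)
      ((fun x => x.2 - h q x.1) @^-1` [set s | 0 <= s]).
    apply/seteqP; split=> x Ex q Aq; have := Ex q Aq; rewrite /= subr_ge0 //.
  apply: closed_bigI => q _.
  apply: preimage_closed (@closed_ge R 0) => x _.
  have c1 : y.1 @[y --> x] --> x.1 by apply: cvg_fst.
  have c2 : y.1.1 @[y --> x] --> x.1.1.
    by apply: (cvg_comp (@fst (H * H) R) fst c1); apply: cvg_fst.
  have c3 : y.1.2 @[y --> x] --> x.1.2.
    by apply: (cvg_comp (@fst (H * H) R) snd c1); apply: cvg_snd.
  apply: cvgB; first by apply: cvg_snd.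
  apply: cvgD; last by apply: cvgMr; apply: cvgD; exact: cvg_inner.
  apply: cvgB; last exact: cvg_cst.
  by apply: cvgD; apply: cvg_inner => //; exact: cvg_cst.
- by exists (q0, inner q0.1 q0.2 + 2^-1 * (inner q0.1 q0.1 + inner q0.2 q0.2));
    exact: E_self.
- by move=> x /E_ge; apply: le_trans; rewrite mulr_ge0 // inner_ge0.
- move=> x y l Ex Ey /andP[l0 l1] q Aq /=.
  have h1 : (1 - l) * h q x.1 <= (1 - l) * x.2.
    by rewrite ler_wpM2l ?subr_ge0 //; exact: Ex.
  have h2 : l * h q y.1 <= l * y.2 by rewrite ler_wpM2l //; exact: Ey.
  (* Up to an affine term, [h q] is half the squared norm, so its convexity gap is exactly [D]. *)
  suff -> : h q ((1 - l) *: x.1 + l *: y.1) =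
      (1 - l) * h q x.1 + l * h q y.1 - l * (1 - l) * D x.1 y.1.
    by rewrite lerD2r lerD.
  rewrite /h /D /= !innerE (innerC y.1.1 x.1.1) (innerC y.1.2 x.1.2).
  by field.
have t_ge := E_ge _ Ewt.
(* Growth at the minimizer, tested on graph points through [E_self]. *)
have key q : gra A q -> t + 2^-1 * inner (w.1 + w.2) (w.1 + w.2)
    <= inner (q.1 + w.2) (q.2 + w.1).
  move=> /E_self/wmin; rewrite /D /= !innerE.
  by rewrite (innerC w.2 w.1) (innerC q.1 w.1) (innerC q.2 w.2); lra.
have Aw : gra A (- w.2, - w.1).
  apply: relA => q /key /=; rewrite -!opprD innerNl innerNr opprK.
  rewrite (addrC w.2) (addrC w.1 q.2); apply: le_trans.
  have := inner_ge0 (w.1 + w.2); move: t_ge => /=; lra.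
(* At [q = (- w.2, - w.1)] the right side of [key] vanishes, while the left one is at least
   [|w.1 + w.2|^2]. *)
have w0 : w.1 + w.2 = 0.
  apply/eqP; rewrite -inner_eq0; have := inner_ge0 (w.1 + w.2).
  have := key _ Aw; move: t_ge; rewrite /= !addNr inner0l => *.
  apply/eqP; lra.
have w2 : - w.2 = w.1 by apply/eqP; rewrite eq_sym -addr_eq0 w0.
by exists w.1; rewrite -{1}w2.
Qed.

(** Translation by [z] and scaling by [g] reduce the equation to [minty0] for [A'], which inherits
    maximality. *)
Lemma minty A (g : R) (z : H) : maximally_monotone A -> 0 < g ->
  exists x u, A x u /\ x + g *: u = z.
Proof.
move=> /maximally_monotoneP[monA relA] g0.
have gn0 : g != 0 by rewrite gt_eqF.
pose A' x := [set u | A (z + x) (g^-1 *: u)].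
have [|x A'x] := @minty0 A'; last first.
  exists (z + x), (g^-1 *: (- x)); split => //.
  by rewrite scalerA mulfV // scale1r addrK.
apply/maximally_monotoneP; split=> [p q A'p A'q|p relp].
  have /= := monA (z + p.1, g^-1 *: p.2) (z + q.1, g^-1 *: q.2) A'p A'q.
  rewrite opprD addrACA subrr add0r -scalerBr innerZr pmulr_rge0 //.
  by rewrite invr_gt0.
apply: (relA (z + p.1, g^-1 *: p.2)) => q Aq /=.
have /relp /= : gra A' (q.1 - z, g *: q.2).
  by rewrite /gra /A' /= addrC subrK scalerA mulVf // scale1r.
rewrite opprB addrCA -addrA.
have -> : p.2 - g *: q.2 = g *: (g^-1 *: p.2 - q.2).
  by rewrite scalerBr scalerA mulfV // scale1r.
by rewrite innerZr pmulr_rge0 // addrCA addrA.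
Qed.

End Minty.

(** * The resolvent cocomposition *)

(** Converse of Minty's theorem: comparing a related point with the graph point of equal [x + g u]
    forces [- g |p2 - u|^2 >= 0]. *)
Lemma monotone_resolvent_maximal (R : realType) (H : hilbertType R)
    (A : H -> set H) (g : R) : 0 < g -> Defs.monotone A ->
    (forall z, exists x u, A x u /\ x + g *: u = z) ->
  maximally_monotone A.
Proof.
move=> g0 monA surjA; apply/maximally_monotoneP; split=> // -[p1 p2] relp.
have [x [u [Axu xuE]]] := surjA (p1 + g *: p2).
have pxE : p1 - x = - (g *: (p2 - u)).
  have -> : x = p1 + g *: p2 - g *: u by rewrite -xuE addrK.
  by rewrite scalerBr -addrA opprD addrA subrr add0r.
have u0 : p2 = u.
  apply/eqP; rewrite -subr_eq0 -inner_eq0 eq_le inner_ge0 andbT.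
  have := relp (x, u) Axu; rewrite /= pxE innerNl innerZl oppr_ge0.
  by rewrite pmulr_rle0.
move: pxE; rewrite u0 subrr scaler0 oppr0 => /eqP; rewrite subr_eq0 => /eqP ->.
exact: Axu.
Qed.

Section ResolventCocomposition.
Context {R : realType} {H G : hilbertType R} (L : {linear H -> G}).
Context (B : G -> set G).
Hypothesis L_cont : continuous L.
Hypothesis L_le1 : forall x, `|L x| <= `|x|.
Hypothesis B_max : maximally_monotone B.
Local Notation Ladj := (adjoint L).
Local Notation LBL := (op_comp Ladj B L).

(** The point [v = L (x + g u) - g y] solves [v + g y = L (x + g u)] with [y] in [B v], an equation
    within reach of Minty's theorem for [B]. *)
Lemma resolvent_cocompP (g : R) x u : resolvent_cocomp L g B x u <->
  exists2 y, B (L (x + g *: u) - g *: y) y & Ladj y = u.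
Proof.
rewrite /resolvent_cocomp /resolvent_comp /parallel_comp /op_inv /op_add.
rewrite /op_scale /op_id /op_comp /= !invrK; split.
  move=> [a [y [v Bvy [_ [_ -> <-] vyE]] yu] [_ [_ -> <-] auE]].
  by exists y => //; rewrite -auE scaleNr subrK -vyE addrK.
move=> [y By yu]; exists (x + g *: u).
  exists y => //; exists (L (x + g *: u) - g *: y) => //.
  by exists (g *: y); [exists y | rewrite subrK].
by exists (- g *: u); [exists u | rewrite scaleNr addrK].
Qed.

Let adjB u v : Ladj (u - v) = Ladj u - Ladj v.
Proof.
have lin := adjoint_is_linear L_cont L_le1.
by rewrite addrC -scaleN1r lin scaleN1r addrC.
Qed.

Let adjZ a u : Ladj (a *: u) = a *: Ladj u.
Proof.
have lin := adjoint_is_linear L_cont L_le1.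
have adj0 : Ladj 0 = 0 by rewrite -[X in Ladj X](subrr 0) adjB subrr.
by have := lin a u 0; rewrite adj0 !addr0.
Qed.

Let adj_sqr_le y : inner (Ladj y) (Ladj y) <= inner y y.
Proof.
by rewrite !inner_normE ler_sqr ?nnegrE //; exact: adjoint_le1.
Qed.

Lemma resolvent_cocomp_onto (g : R) z : 0 < g ->
  exists x u, resolvent_cocomp L g B x u /\ x + g *: u = z.
Proof.
move=> g0; have [v [y [Bvy vyE]]] := minty (L z) B_max g0.
exists (z - g *: Ladj y), (Ladj y); rewrite subrK; split=> //.
by apply/resolvent_cocompP; exists y; rewrite // subrK -vyE addrK.
Qed.

Lemma resolvent_cocomp_monotone (g : R) : 0 < g ->
  Defs.monotone (resolvent_cocomp L g B).
Proof.
move=> g0 [x1 u1] [x2 u2] /resolvent_cocompP[y1 /= By1 u1E].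
move=> /resolvent_cocompP[y2 /= By2 u2E]; subst u1 u2.
(* Monotonicity of [B] leaves the error [g (|L^* (y1 - y2)|^2 - |y1 - y2|^2)], nonpositive since
   [L^*] is a contraction. *)
have [monB _] := B_max; have := monB (_, _) (_, _) By1 By2.
have := adj_sqr_le (y1 - y2); rewrite -(ler_pM2l g0) adjB.
rewrite /= !(linearD, linearZ) /= !innerE !(inner_adjoint L_cont L_le1).
rewrite (innerC y2 y1) (innerC (Ladj y2) (Ladj y1)); lra.
Qed.

Lemma resolvent_cocomp_maximal (g : R) : 0 < g ->
  maximally_monotone (resolvent_cocomp L g B).
Proof.
move=> g0; apply: (monotone_resolvent_maximal g0).
  exact: resolvent_cocomp_monotone.
by move=> z; exact: resolvent_cocomp_onto.
Qed.

(* Compares the resolvents of [L^* o B o L] and of the cocomposition at a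
   common point; the right-hand side involves [y] only, because the quadratic
   form of [Id - L L^*] is nonnegative at [w - y / 2]. *)
Lemma resolvent_cocomp_dist (g : R) x y p w : 0 <= g -> B (L x) y ->
    B (L (p + g *: Ladj w) - g *: w) w -> x + Ladj y = p + Ladj w ->
  4 * `|x - p| ^+ 2 <= g * `|y| ^+ 2.
Proof.
move=> g0 Bxy Bpw xpE.
have -> : p = x + Ladj y - Ladj w by rewrite xpE addrK.
move: Bpw; have {xpE p} -> : p = x + Ladj y - Ladj w by rewrite xpE addrK.
(* With [T = Id - L L^*], monotonicity gives [|x - p|^2 <= g <T w, y - w>]; completing the square
   bounds this by [g <T y, y> / 4]. *)
move=> Bpw; have [monB _] := B_max; have := monB (_, _) (_, _) Bxy Bpw.
have := ler_wpM2l g0 (adj_sqr_le (w - 2^-1 *: y)); rewrite adjB adjZ.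
have := mulr_ge0 g0 (inner_ge0 (Ladj y)).
rewrite -!inner_normE /= !(linearD, linearB, linearZ) /= !innerE.
rewrite !(inner_adjoint L_cont L_le1) (innerC y w) (innerC (Ladj y) (Ladj w)).
rewrite !innerNl (innerC (Ladj y) x) (innerC (Ladj w) x); lra.
Qed.

End ResolventCocomposition.

(** * Convergence of the cocompositions *)

Lemma opnorm_le1 (R : realType) (V W : normedModType R) (f : {linear V -> W}) :
  (opnorm f <= 1)%E -> forall x, `|f x| <= `|x|.
Proof.
move=> f1 x; have [->|x0] := eqVneq x 0; first by rewrite linear0 !normr0.
have nx : 0 < `|x| by rewrite normr_gt0.
have : ((`|f (`|x|^-1 *: x)|)%:E <= 1)%E.
  apply: le_trans f1; apply: ereal_sup_ubound.
  exists (`|x|^-1 *: x) => //=.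
  by rewrite normrZ normfV normr_id mulVf ?gt_eqF.
rewrite lee_fin linearZ normrZ normfV normr_id.
by rewrite ler_pdivrMl // mulr1.
Qed.

Lemma bounded_operator_le (R : realType) (V W : normedModType R)
    (f : {linear V -> W}) : bounded_operator f ->
  exists2 c, 0 <= c & forall x, `|f x| <= c * `|x|.
Proof.
by move=> /linear_boundedP/pinfty_ex_gt0[c c0 cP]; exists c => //; exact: ltW.
Qed.

(** With equal sums the two coordinate differences are opposite, so they have the same norm. *)
Lemma prod_norm_sub_le (R : realType) (V : normedModType R) (p q : V * V)
    (e : R) : p.1 + p.2 = q.1 + q.2 -> `|p.1 - q.1| <= e -> `|p - q| <= e.
Proof.
move=> pqE pq1; rewrite prod_normE ge_max /= pq1 /=.
suff -> : p.2 - q.2 = q.1 - p.1 by rewrite distrC.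
by apply/eqP; rewrite subr_eq addrAC -pqE addrAC subrr add0r.
Qed.

(** The [+ 1] keeps the threshold on [g] meaningful when [M = 0]. *)
Lemma dist_lt (R : realType) (d e g M : R) : 0 <= d -> 0 < e -> 0 <= g ->
  4 * d ^+ 2 <= g * M ^+ 2 -> g < 4 * e ^+ 2 / (M ^+ 2 + 1) -> d < e.
Proof.
move=> d0 e0 g0 dM; have M0 : 0 < M ^+ 2 + 1 by rewrite ltr_wpDl ?sqr_ge0.
rewrite ltr_pdivlMr // mulrDr mulr1 => gM.
have : d ^+ 2 < e ^+ 2 by lra.
by rewrite ltr_pXn2r ?nnegrE // ltW.
Qed.

(** * Bounds for excesses and Hausdorff distances *)

Section Excess.
Context {R : realType} {V : normedModType R}.
Implicit Types C D : set V.

Lemma dist_to_ge0 D x : (0 <= dist_to D x)%E.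
Proof. by apply: le_ereal_inf_tmp => _ [y _ <-]; rewrite lee_fin. Qed.

Lemma excess_ge0 C D : (0 <= excess C D)%E.
Proof.
rewrite /excess; case: asboolP => // /eqP/set0P[x Cx].
by apply: le_trans (dist_to_ge0 D x) _; apply: ereal_sup_ubound; exists x.
Qed.

Lemma excess_le C D e : 0 <= e ->
    (forall x, C x -> exists2 y, D y & `|x - y| <= e) ->
  (excess C D <= e%:E)%E.
Proof.
move=> e0 CD; rewrite /excess; case: asboolP => _; first by rewrite lee_fin.
apply: ge_ereal_sup => _ [x Cx <-]; have [y Dy xye] := CD x Cx.
apply: (@le_trans _ _ (`|x - y|)%:E) => //.
by apply: ereal_inf_lbound; exists y.
Qed.

Lemma haus_ge0 rho C D : (0 <= haus rho C D)%E.
Proof. by rewrite /haus le_max excess_ge0. Qed.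

Lemma haus_le rho C D e : 0 <= e ->
    (forall x, C x -> `|x| <= rho -> exists2 y, D y & `|x - y| <= e) ->
    (forall x, D x -> `|x| <= rho -> exists2 y, C y & `|x - y| <= e) ->
  (haus rho C D <= e%:E)%E.
Proof.
move=> e0 CD DC; rewrite /haus ge_max.
by apply/andP; split; apply: excess_le => // x [Sx xr]; [exact: CD | exact: DC].
Qed.

End Excess.

Lemma cvge_at0 (R : realType) (T : Type) (F : set_system T) (FF : Filter F)
    (f : T -> \bar R) : (forall t, 0 <= f t)%E ->
    (forall e : R, 0 < e -> \forall t \near F, (f t <= e%:E)%E) ->
  f @ F --> 0%E.
Proof.
move=> f0 fe; apply/fine_cvgP; split.
  near=> t; rewrite ge0_fin_numE //; apply: (@le_lt_trans _ _ 1%:E).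
    by near: t; exact: fe.
  exact: ltry.
apply/cvgrPdist_le => e e0; near=> t.
have fte : (f t <= e%:E)%E by near: t; exact: fe.
have ftfin : f t \is a fin_num.
  by rewrite ge0_fin_numE //; apply: le_lt_trans fte (ltry _).
rewrite sub0r normrN ger0_norm ?fine_ge0 //=.
by rewrite -lee_fin fineK.
Unshelve. all: by end_near. Qed.

Section Convergence.
Context {R : realType} {H G : hilbertType R} (L : {linear H -> G}).
Context (B : G -> set G).
Hypothesis L_cont : continuous L.
Hypothesis L_le1 : forall x, `|L x| <= `|x|.
Hypothesis B_max : maximally_monotone B.
Local Notation LBL := (op_comp (adjoint L) B L).
Local Notation LcB g := (resolvent_cocomp L g B).
Hypothesis LBL_max : maximally_monotone LBL.

(** Minty's theorem for the cocomposition, at the sum [x + L^* y], provides [p]. *)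
Lemma gra_cocomp_near (g : R) (x : H) (y : G) : 0 < g -> B (L x) y ->
  exists p, [/\ gra (LcB g) p, x + adjoint L y = p.1 + p.2
    & 4 * `|x - p.1| ^+ 2 <= g * `|y| ^+ 2].
Proof.
move=> g0 Bxy.
have max := resolvent_cocomp_maximal L_cont L_le1 B_max g0.
have [p [u [pu puE]]] := minty (x + adjoint L y) max ltr01.
rewrite scale1r in puE.
have /resolvent_cocompP[w Bw wu] := pu; subst u.
exists (p, adjoint L w); split => //.
exact: (resolvent_cocomp_dist L_cont L_le1 B_max (ltW g0) Bxy Bw).
Qed.

Lemma gra_cocomp_lower (g : nat -> R) (p : H * H) : (forall n, 0 < g n) ->
    g @ \oo --> 0 -> gra LBL p ->
  lower_limit (fun n => gra (LcB (g n))) p.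
Proof.
move=> g0 gcvg [y Bxy yE].
have /choice[u uP] n := gra_cocomp_near (g0 n) Bxy.
exists u; split=> [n|]; first by case: (uP n).
apply/cvgrPdist_le => e e0; near=> n; have [_ uE un] := uP n.
apply: prod_norm_sub_le; first by rewrite -yE uE.
apply: ltW; apply: (dist_lt _ e0 (ltW (g0 n)) un) => //.
near: n; apply: (cvgr_lt _ gcvg).
by rewrite divr_gt0 ?mulr_gt0 ?exprn_gt0 // ltr_wpDl ?sqr_ge0.
Unshelve. all: by end_near. Qed.

Lemma resolvent_cocomp_graph_cvg : graph_cvg_at0 (fun g => LcB g) LBL.
Proof.
move=> g g0 gcvg; have [_ relLBL] := (maximally_monotoneP LBL).1 LBL_max.
have lower p : gra LBL p -> lower_limit (fun n => gra (LcB (g n))) p.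
  exact: gra_cocomp_lower.
have lower_upper : lower_limit (fun n => gra (LcB (g n))) `<=`
    upper_limit (fun n => gra (LcB (g n))).
  by move=> p [u [uP up]]; exists id, u; split => // m n.
have upper : upper_limit (fun n => gra (LcB (g n))) `<=` gra LBL.
  (* The limit [p] is tested against a recovery sequence [v] of each [q]: monotonicity passes to the
     limit, and maximality of [L^* B L] concludes. *)
  move=> p [k [u [kinc uP up]]]; apply: relLBL => q /lower[v [vP vq]].
  have kge n : (n <= k n)%N.
    by elim: n => // n IHn; apply: leq_ltn_trans IHn _; exact: kinc.
  have vkq : v (k n) @[n --> \oo] --> q.
    apply: (cvg_comp k v _ vq) => A [N _ NA].
    by exists N => // n /= Nn; apply: NA; exact: leq_trans Nn (kge n).
  have hge n : 0 <= inner ((u n).1 - (v (k n)).1) ((u n).2 - (v (k n)).2).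
    exact: (resolvent_cocomp_monotone L_cont L_le1 B_max (g0 (k n))).
  have fstc (w : nat -> H * H) (r : H * H) :
      w @ \oo --> r -> (w n).1 @[n --> \oo] --> r.1.
    by move=> wr; apply: (cvg_comp w fst wr); apply: cvg_fst.
  have sndc (w : nat -> H * H) (r : H * H) :
      w @ \oo --> r -> (w n).2 @[n --> \oo] --> r.2.
    by move=> wr; apply: (cvg_comp w snd wr); apply: cvg_snd.
  have ic : inner ((u n).1 - (v (k n)).1) ((u n).2 - (v (k n)).2)
      @[n --> \oo] --> inner (p.1 - q.1) (p.2 - q.2).
    apply: cvg_inner; apply: cvgB.
    - exact: fstc.
    - exact: (fstc (v \o k)).
    - exact: sndc.
    - exact: (sndc (v \o k)).
  by apply: (@closed_cvg _ _ \oo _ _ _ (@closed_ge R 0) _ _ ic); exact: nearW.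
split; apply/seteqP; split=> //.
  exact: subset_trans lower_upper upper.
exact: subset_trans lower lower_upper.
Qed.

(** The hypothesis is the common consequence of (a) and (b); it makes the estimate in [|y|] uniform
    on bounded parts of the graphs. *)
Lemma resolvent_cocomp_haus (rho : R) :
    (forall r : R, exists M : R, forall x y,
       B (L x) y -> `|adjoint L y| <= r -> `|y| <= M) ->
  op_haus rho (LcB g) LBL @[g --> 0^'+] --> 0%E.
Proof.
move=> LBL_bnd; have [monLBL _] := LBL_max.
have [a Aa] := maximally_monotone_nonempty LBL_max.
(* Comparing a sum of norm at most [2 rho] with [a.1 + a.2] costs [2 rho + |a.1| + |a.2|]; passing
   from [L^* y - a.2] to [L^* y] adds another [|a.2|]. *)
have [M MP] := LBL_bnd (2 * rho + `|a.1| + 2 * `|a.2|).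
apply: cvge_at0 => [g|e e0]; first exact: haus_ge0.
near=> g.
have g0 : 0 < g by near: g; exact: nbhs_right_gt.
have gM : g < 4 * e ^+ 2 / (M ^+ 2 + 1).
  near: g; apply: nbhs_right_lt.
  by rewrite divr_gt0 ?mulr_gt0 ?exprn_gt0 // ltr_wpDl ?sqr_ge0.
have close d x y : 0 <= d -> B (L x) y ->
    `|adjoint L y| <= 2 * rho + `|a.1| + 2 * `|a.2| ->
    4 * d ^+ 2 <= g * `|y| ^+ 2 -> d <= e.
  move=> d0 Bxy yM dy; apply: ltW; apply: (dist_lt d0 e0 (ltW g0) _ gM).
  apply: le_trans dy _; rewrite ler_wpM2l ?(ltW g0) //.
  have yleM := MP _ _ Bxy yM.
  by rewrite lerXn2r ?nnegrE // (le_trans _ yleM).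
apply: haus_le (ltW e0) _ _ => -[x u] /= xuP.
  (* From the cocomposition to [L^* B L]: here [y] belongs to the point found, not to the given one,
     hence the detour through [a]. *)
  rewrite prod_normE ge_max /= => /andP[xrho urho].
  have [p [v [pv pvE]]] := minty (x + u) LBL_max ltr01.
  rewrite scale1r in pvE.
  have [y Bpy yv] := pv; subst v.
  have /resolvent_cocompP[w /= Bw wu] := xuP; subst u.
  have d := resolvent_cocomp_dist L_cont L_le1 B_max (ltW g0) Bpy Bw pvE.
  exists (p, adjoint L y) => //.
  apply: prod_norm_sub_le => //=; rewrite distrC.
  apply: (close _ p y _ Bpy _ d) => //.
  have mon := monLBL (p, adjoint L y) a pv Aa.
  rewrite /= in mon.
  (* The resolvent of [A] is nonexpansive, hence [|L^* y|] is bounded. *)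
  have va : `|adjoint L y - a.2| <= `|p + adjoint L y - (a.1 + a.2)|.
    rewrite -ler_sqr ?nnegrE // -!inner_normE opprD addrACA.
    rewrite (innerDl (p - a.1)) !(innerDr (p - a.1)).
    rewrite (innerC (adjoint L y - a.2) (p - a.1)).
    have := inner_ge0 (p - a.1); lra.
  have n1 : `|adjoint L y| <= `|adjoint L y - a.2| + `|a.2|.
    by rewrite -{1}[adjoint L y](subrK a.2); exact: ler_normD.
  have n2 := ler_normB (p + adjoint L y) (a.1 + a.2).
  have n3 := ler_normD a.1 a.2.
  have n4 := ler_normD x (adjoint L w).
  rewrite -pvE in n4; lra.
(* In the other direction [y] comes with the given point, and [|L^* y| <= rho]. *)
rewrite prod_normE ge_max /= => /andP[xrho urho].
have [y Bxy yu] := xuP; rewrite /= in Bxy yu; subst u.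
have [p [pP xpE d]] := gra_cocomp_near g0 Bxy.
exists p => //; apply: prod_norm_sub_le => //=.
apply: (close _ x y _ Bxy _ d) => //; apply: le_trans urho _.
have rho0 : 0 <= rho by apply: le_trans xrho.
have := normr_ge0 a.1; have := normr_ge0 a.2; lra.
Unshelve. all: by end_near. Qed.

End Convergence.

Theorem proposition5p12 (R : realType) (H G : hilbertType R)
    (L : {linear H -> G}) (B : G -> set G)
    (L_bounded : bounded_operator L) (L_le1 : (opnorm L <= 1)%E)
    (B_maxmon : maximally_monotone B)
    (LBL_maxmon : maximally_monotone (op_comp (adjoint L) B L)) :
  graph_cvg_at0 (fun gamma => resolvent_cocomp L gamma B)
    (op_comp (adjoint L) B L)
  /\
  (bounded_set (ran (B \o L)) \/
   (exists S : {linear H -> G},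
     bounded_operator S /\ invertible_operator (S \o adjoint L)) ->
   forall rho : R, 0 < rho ->
     op_haus rho (resolvent_cocomp L gamma B) (op_comp (adjoint L) B L)
       @[gamma --> 0^'+] --> 0%E).
Proof.
have L_cont : continuous L by exact: bounded_linear_continuous.
have L_contr := opnorm_le1 L_le1.
split; first exact: resolvent_cocomp_graph_cvg.
move=> ab rho _; apply: resolvent_cocomp_haus => // r.
case: ab => [/pinfty_ex_gt0[M _ MP]|[S [Sbnd [T [Tbnd ST _]]]]].
  by exists M => x y Bxy _; apply: MP; exists x.
have [s s0 sP] := bounded_operator_le Sbnd.
have [t t0 tP] := bounded_operator_le Tbnd.
(* Under (b), [y = T (S (L^* y))], where [T] is the bounded inverse of [S L^*]. *)
exists (t * (s * r)) => x y _ yr; rewrite -[y]ST.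
apply: le_trans (tP _) _; rewrite ler_wpM2l //.
by apply: le_trans (sP _) _; rewrite ler_wpM2l.
Qed.
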